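(* Let $n\ge 2$ and $d\ge 1$ be integers, let $\Gamma=\mathbb{Z}/d\mathbb{Z}$ with generator $\xi$, and let $\zeta\in\mathbb{C}$ be a primitive $d$-th root of unity. Let $A=\mathbb{C}[u^{\pm 1},v^{\pm 1}]\rtimes\Gamma$ and $B=\mathbb{C}[u^{\pm 1},v]\rtimes\Gamma$, where $\xi(u)=\zeta u$ and $\xi(v)=\zeta^{-1}v$. Then the Lie algebra $\mathfrak{sl}_n(A)$ is isomorphic to $\mathfrak{sl}_{nd}(\mathbb{C}[s^{\pm 1},t^{\pm 1}])$, and the Lie algebra $\mathfrak{sl}_n(B)$ is isomorphic to $\mathfrak{sl}_{nd}(\mathbb{C}[s^{\pm 1},t])$.
   Context: All algebras are over $\mathbb{C}$. For an associative unital algebra $A$, $\mathfrak{gl}_n(A)=\mathfrak{gl}_n\otimes A$ with the commutator bracket of matrices, and $\mathfrak{sl}_n(A)=[\mathfrak{gl}_n(A),\mathfrak{gl}_n(A)]$. For a ring $R$ with action of a group $\Gamma$, $R\rtimes \Gamma$ is the smash product, spanned by elements $a\gamma$ ($a\in R,\gamma\in \Gamma$) with product $(a_1\gamma_1)(a_2\gamma_2)=a_1\gamma_1(a_2)\gamma_1\gamma_2$. *)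

(* Defs.v *)
From HB Require Import structures.
From mathcomp Require Import all_boot all_order all_algebra all_fingroup.
From mathcomp Require Import cyclic.
From mathcomp Require Import boolp reals complex.
From mathcomp Require Import finmap monalg.

Set Implicit Arguments.
Unset Strict Implicit.
Unset Printing Implicit Defensive.

Import GRing.Theory.
Local Open Scope ring_scope.

HB.mixin Record Lmodule_isLie (K : comNzRingType) L of GRing.Lmodule K L := {
  lie_bracket : L -> L -> L;
  lie_linearl : forall z, linear (lie_bracket^~ z);
  lie_linearr : forall z, linear (lie_bracket z);
  lie_alt : forall x, lie_bracket x x = 0;
  lie_jacobi : forall x y z,
    lie_bracket x (lie_bracket y z) + lie_bracket y (lie_bracket z x)
      + lie_bracket z (lie_bracket x y) = 0
}.

#[short(type="lieAlgType")]
HB.structure Definition LieAlgebra (K : comNzRingType) :=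
  { L of GRing.Lmodule K L & Lmodule_isLie K L }.

Section Derived.
Variables (K : comNzRingType) (L : lieAlgType K).

Definition in_derived : {pred L} := fun x =>
  `[< exists s : seq (K * (L * L)),
        x = \sum_(p <- s) p.1 *: lie_bracket p.2.1 p.2.2 >].

Lemma in_derivedP x :
  reflect (exists s : seq (K * (L * L)),
             x = \sum_(p <- s) p.1 *: lie_bracket p.2.1 p.2.2)
          (x \in in_derived).
Proof. exact: asboolP. Qed.

Fact in_derived_submod : subsemimod_closed in_derived.
Proof.
split; first split.
- by apply/in_derivedP; exists [::]; rewrite big_nil.
- move=> _ _ /in_derivedP[s ->] /in_derivedP[t ->].
  by apply/in_derivedP; exists (s ++ t); rewrite big_cat.
- move=> c _ /in_derivedP[s ->]; apply/in_derivedP.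
  exists [seq (c * p.1, p.2) | p <- s].
  by rewrite big_map scaler_sumr; apply: eq_bigr => p _; rewrite /= scalerA.
Qed.

Record derived : predArgType :=
  Derived { derived_val : L; derived_valP : derived_val \in in_derived }.

HB.instance Definition _ := [isSub for derived_val].
HB.instance Definition _ := [Choice of derived by <:].
HB.instance Definition _ :=
  GRing.SubChoice_isSubLmodule.Build K L in_derived derived in_derived_submod.

Fact derived_bracket_subproof (x y : derived) :
  lie_bracket (val x) (val y) \in in_derived.
Proof.
by apply/in_derivedP; exists [:: (1, (val x, val y))]; rewrite big_seq1 scale1r.
Qed.

Definition derived_bracket (x y : derived) : derived :=
  Derived (derived_bracket_subproof x y).

Fact derived_linearl z : linear (derived_bracket^~ z).
Proof.
by move=> c x y; apply: val_inj; exact: lie_linearl.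
Qed.

Fact derived_linearr z : linear (derived_bracket z).
Proof.
by move=> c x y; apply: val_inj; exact: lie_linearr.
Qed.

Fact derived_alt x : derived_bracket x x = 0.
Proof. by apply: val_inj; exact: lie_alt. Qed.

Fact derived_jacobi x y z :
  derived_bracket x (derived_bracket y z) + derived_bracket y (derived_bracket z x)
    + derived_bracket z (derived_bracket x y) = 0.
Proof. by apply: val_inj; exact: lie_jacobi. Qed.

HB.instance Definition _ := Lmodule_isLie.Build K derived
  derived_linearl derived_linearr derived_alt derived_jacobi.

End Derived.

Definition lie_isomorphic (K : comNzRingType) (L1 L2 : lieAlgType K) : Prop :=
  exists2 f : {linear L1 -> L2},
    bijective f & forall x y, f (lie_bracket x y) = lie_bracket (f x) (f y).

(* A synonym of 'M[A]_n, because 'M[A]_n is canonically a module over A, while *)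
(* the Lie algebra gl_n(A) is one over the base ring K.                        *)
Definition gl (K : comNzRingType) (A : algType K) (n : nat) : Type := 'M[A]_n.

Section GL.
Variables (K : comNzRingType) (A : algType K) (n : nat).

HB.instance Definition _ := GRing.Zmodule.copy (gl A n) 'M[A]_n.

Definition gl_scale (c : K) (X : gl A n) : gl A n :=
  map_mx (fun a : A => c *: a) X.

Fact gl_scaleA a b X : gl_scale a (gl_scale b X) = gl_scale (a * b) X.
Proof. by apply/matrixP=> i j; rewrite !mxE scalerA. Qed.
Fact gl_scale1 : left_id 1 gl_scale.
Proof. by move=> X; apply/matrixP=> i j; rewrite !mxE scale1r. Qed.
Fact gl_scaleDr : right_distributive gl_scale +%R.
Proof. by move=> c X Y; apply/matrixP=> i j; rewrite !mxE scalerDr. Qed.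
Fact gl_scaleDl X : {morph gl_scale^~ X : a b / a + b}.
Proof. by move=> a b; apply/matrixP=> i j; rewrite !mxE scalerDl. Qed.

HB.instance Definition _ := GRing.Zmodule_isLmodule.Build K (gl A n)
  gl_scaleA gl_scale1 gl_scaleDr gl_scaleDl.

Definition gl_bracket (X Y : gl A n) : gl A n := (X *m Y - Y *m X : 'M[A]_n).

Fact gl_mulZl c (X Y : 'M[A]_n) : gl_scale c X *m Y = gl_scale c (X *m Y).
Proof.
apply/matrixP=> i j; rewrite !mxE scaler_sumr; apply: eq_bigr => k _.
by rewrite !mxE scalerAl.
Qed.

Fact gl_mulZr c (X Y : 'M[A]_n) : X *m gl_scale c Y = gl_scale c (X *m Y).
Proof.
apply/matrixP=> i j; rewrite !mxE scaler_sumr; apply: eq_bigr => k _.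
by rewrite !mxE scalerAr.
Qed.

Fact gl_linearl Z : linear (gl_bracket^~ Z).
Proof.
move=> c X Y; rewrite /gl_bracket scalerBr.
rewrite [(_ + _) *m Z]mulmxDl [Z *m (_ + _)]mulmxDr gl_mulZl gl_mulZr opprD.
by rewrite addrACA.
Qed.

Fact gl_linearr Z : linear (gl_bracket Z).
Proof.
move=> c X Y; rewrite /gl_bracket scalerBr.
rewrite [(_ + _) *m Z]mulmxDl [Z *m (_ + _)]mulmxDr gl_mulZl gl_mulZr opprD.
by rewrite addrACA.
Qed.

Fact gl_alt X : gl_bracket X X = 0.
Proof. exact: subrr. Qed.

Fact gl_jacobi X Y Z :
  gl_bracket X (gl_bracket Y Z) + gl_bracket Y (gl_bracket Z X)
    + gl_bracket Z (gl_bracket X Y) = 0.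
Proof.
rewrite /gl_bracket !mulmxBl !mulmxBr !mulmxA !opprB !addrA.
rewrite [LHS](ACl ((1*12)*(7*2)*(3*10)*(5*4)*(11*6)*(9*8)))%AC /=.
by rewrite !subrr !addr0.
Qed.

HB.instance Definition _ := Lmodule_isLie.Build K (gl A n)
  gl_linearl gl_linearr gl_alt gl_jacobi.

Definition sl : lieAlgType K := derived (gl A n).

End GL.

(* The algebra of a commutative monoid M written additively: finite formal     *)
(* combinations of elements of M, with << m >> * << m' >> = << m + m' >>.      *)
(* A synonym of {malg K[M]}, whose library product only covers monoids without *)
(* nontrivial units.                                                           *)
Definition monoidAlg (K : comNzRingType) (M : nmodType) : Type := {malg K[M]}.

Section MonoidAlgebra.
Variables (K : comNzRingType) (M : nmodType).
Local Notation KM := (monoidAlg K M).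

HB.instance Definition _ := GRing.Lmodule.copy KM {malg K[M]}.

Definition monomial (m : M) : KM := << m >>.


Implicit Types (m : M) (f g h : KM) (c : K).

Definition monoidAlg_mul f g : KM :=
  \sum_(m <- msupp f) \sum_(m' <- msupp g) (f@_m * g@_m') *: monomial (m + m').

Lemma monomialZ c m : c *: monomial m = << c *g m >>.
Proof. by apply/malgP=> k; rewrite mcoeffZ !mcoeffU mulr_natr. Qed.

Lemma monoidAlgE f : f = \sum_(m <- msupp f) f@_m *: monomial m.
Proof.
by rewrite {1}[f]monalgE; apply: eq_bigr => m _; rewrite monomialZ.
Qed.

Definition lin_ext (V : lmodType K) (phi : M -> V) f : V :=
  \sum_(m <- msupp f) f@_m *: phi m.

Lemma lin_extEw (V : lmodType K) (phi : M -> V) f (D : {fset M}) :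
  (msupp f `<=` D)%fset -> lin_ext phi f = \sum_(m <- D) f@_m *: phi m.
Proof.
move=> sfD; rewrite /lin_ext.
rewrite -[RHS](big_fset_incl _ sfD) // => m _ /mcoeff_outdom ->.
by rewrite scale0r.
Qed.

Fact lin_ext_linear (V : lmodType K) (phi : M -> V) : linear (lin_ext phi).
Proof.
move=> c f g; pose D := (msupp f `|` msupp g `|` msupp (c *: f + g))%fset.
rewrite !(@lin_extEw _ _ _ D) ?fsubsetUr //; first last.
- by rewrite /D -fsetUA fsubsetUl.
- by rewrite /D fsetUAC fsubsetUr.
rewrite scaler_sumr -big_split; apply: eq_bigr => m _ /=.
by rewrite mcoeffD mcoeffZ scalerDl scalerA.
Qed.

HB.instance Definition _ (V : lmodType K) (phi : M -> V) :=
  GRing.isLinear.Build K KM V *:%R (lin_ext phi) (lin_ext_linear phi).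

Lemma lin_ext_monomial (V : lmodType K) (phi : M -> V) m :
  lin_ext phi (monomial m) = phi m.
Proof.
rewrite (@lin_extEw _ _ _ [fset m]%fset) ?msuppU_le // big_seq_fset1.
by rewrite mcoeffUU scale1r.
Qed.

Lemma monoidAlg_ext (V : lmodType K) (F G : {linear KM -> V}) :
  (forall m, F (monomial m) = G (monomial m)) -> F =1 G.
Proof.
move=> FG f; rewrite [f]monoidAlgE !linear_sum.
by apply: eq_bigr => m _; rewrite !linearZ /= FG.
Qed.

Lemma monoidAlg_mulE f g :
  monoidAlg_mul f g
  = lin_ext (fun m => lin_ext (fun m' => monomial (m + m')) g) f.
Proof.
apply: eq_bigr => m _; rewrite scaler_sumr.
by apply: eq_bigr => m' _; rewrite scalerA.
Qed.

Lemma monoidAlg_mulEr f g :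
  monoidAlg_mul f g
  = lin_ext (fun m' => lin_ext (fun m => monomial (m + m')) f) g.
Proof.
rewrite /monoidAlg_mul exchange_big; apply: eq_bigr => m _ /=.
rewrite scaler_sumr; apply: eq_bigr => m' _.
by rewrite scalerA mulrC.
Qed.

Fact monoidAlg_mul_linearl g : linear (monoidAlg_mul^~ g).
Proof. by move=> c f h; rewrite !monoidAlg_mulE linearP. Qed.

Fact monoidAlg_mul_linearr f : linear (monoidAlg_mul f).
Proof. by move=> c g h; rewrite !monoidAlg_mulEr linearP. Qed.

Lemma monomialM m m' :
  monoidAlg_mul (monomial m) (monomial m') = monomial (m + m').
Proof. by rewrite monoidAlg_mulE !lin_ext_monomial. Qed.

Lemma monoidAlg_ind (P : KM -> Prop) :
  (forall m, P (monomial m)) ->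
  (forall c f g, P f -> P g -> P (c *: f + g)) -> forall f, P f.
Proof.
move=> Pm Plin f; rewrite [f]monoidAlgE.
elim: (X in \sum_(m <- X) _) => [|m s IHs]; last by rewrite big_cons; apply: Plin.
rewrite big_nil -(addNr (monomial 0)) -scaleN1r; exact: Plin.
Qed.

Fact monoidAlg_mulA : associative monoidAlg_mul.
Proof.
move=> f g h; elim/monoidAlg_ind: f => [m|c f1 f2 IH1 IH2]; last first.
  by rewrite !monoidAlg_mul_linearl IH1 IH2.
elim/monoidAlg_ind: g => [m'|c f1 f2 IH1 IH2]; last first.
  rewrite monoidAlg_mul_linearl !monoidAlg_mul_linearr monoidAlg_mul_linearl.
  by rewrite IH1 IH2.
elim/monoidAlg_ind: h => [m''|c f1 f2 IH1 IH2]; last first.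
  by rewrite !monoidAlg_mul_linearr IH1 IH2.
by rewrite !monomialM addrA.
Qed.

Fact monoidAlg_mulC : commutative monoidAlg_mul.
Proof.
move=> f g; elim/monoidAlg_ind: f => [m|c f1 f2 IH1 IH2]; last first.
  by rewrite monoidAlg_mul_linearl monoidAlg_mul_linearr IH1 IH2.
elim/monoidAlg_ind: g => [m'|c f1 f2 IH1 IH2]; last first.
  by rewrite monoidAlg_mul_linearl monoidAlg_mul_linearr IH1 IH2.
by rewrite !monomialM addrC.
Qed.

Fact monoidAlg_mul1 : left_id (monomial 0) monoidAlg_mul.
Proof.
move=> f; elim/monoidAlg_ind: f => [m|c f1 f2 IH1 IH2].
  by rewrite monomialM add0r.
by rewrite monoidAlg_mul_linearr IH1 IH2.
Qed.

Fact monoidAlg_mulDl : left_distributive monoidAlg_mul +%R.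
Proof.
by move=> f g h; have := monoidAlg_mul_linearl h 1 f g; rewrite !scale1r.
Qed.

Fact monoidAlg_1_neq0 : monomial 0 != 0.
Proof. by rewrite monalgU_eq0 oner_eq0. Qed.

HB.instance Definition _ := GRing.Zmodule_isComNzRing.Build KM
  monoidAlg_mulA monoidAlg_mulC monoidAlg_mul1 monoidAlg_mulDl monoidAlg_1_neq0.

Fact monoidAlg_scaleAl c f g : c *: (f * g) = (c *: f) * g.
Proof.
rewrite -[c *: f]addr0 [RHS](monoidAlg_mul_linearl g c f 0).
by rewrite [X in _ = _ + X](mul0r g) addr0.
Qed.

HB.instance Definition _ := GRing.Lmodule_isLalgebra.Build K KM monoidAlg_scaleAl.
HB.instance Definition _ := GRing.Lalgebra_isComAlgebra.Build K KM.

End MonoidAlgebra.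

(* K[u^{+-1}, v^{+-1}] and K[u^{+-1}, v], with u^i v^j = monomial (i, j).        *)
Notation laurent K := (monoidAlg K (int * int)%type).
Notation half_laurent K := (monoidAlg K (int * nat)%type).

Definition laurent_u (K : comNzRingType) : laurent K := monomial K (1, 0).
Definition laurent_v (K : comNzRingType) : laurent K := monomial K (0, 1).
Definition half_laurent_u (K : comNzRingType) : half_laurent K :=
  monomial K (1, 0%N).
Definition half_laurent_v (K : comNzRingType) : half_laurent K :=
  monomial K (0, 1%N).

Record algAction (K : comNzRingType) (A : algType K) (Gamma : finGroupType) :=
  AlgAction {
    act :> Gamma -> {lrmorphism A -> A};
    act1 : forall a, act 1%g a = a;
    actM : forall g h a, act (g * h)%g a = act g (act h a)
  }.

(* x : Gamma -> A encodes the sum over g in Gamma of the elements x(g) g, so   *)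
(* that smash_elt a g below is the element a g.                                *)
Definition smash (K : comNzRingType) (A : algType K) (Gamma : finGroupType)
  (rho : algAction A Gamma) : Type := {ffun Gamma -> A}.

Section Smash.
Variables (K : comNzRingType) (A : algType K) (Gamma : finGroupType).
Variable rho : algAction A Gamma.
Local Notation S := (smash rho).

HB.instance Definition _ := GRing.Lmodule.copy S {ffun Gamma -> A}.

Implicit Types (a b : A) (g h : Gamma) (x y z : S).

Definition smash_elt a g : S := [ffun h => a *+ (h == g)].

Definition smash_mul x y : S :=
  \sum_(g : Gamma) \sum_(h : Gamma) smash_elt (x g * rho g (y h)) (g * h)%g.

Lemma smash_eltP g : linear (smash_elt^~ g).
Proof.
move=> c a b; apply/ffunP=> h; rewrite !ffunE.
by case: eqP; rewrite ?mulr1n // !mulr0n scaler0 addr0.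
Qed.

Lemma smash_elt0 g : smash_elt 0 g = 0.
Proof. by apply/ffunP=> h; rewrite !ffunE mul0rn. Qed.

Lemma smash_ind (P : S -> Prop) :
  (forall a g, P (smash_elt a g)) -> (forall x y, P x -> P y -> P (x + y)) ->
  forall x, P x.
Proof.
move=> Pe PD x; have -> : x = \sum_g smash_elt (x g) g.
  apply/ffunP=> h; rewrite sum_ffunE (bigD1 h) //= ffunE eqxx mulr1n.
  rewrite big1 ?addr0 // => g /negPf gh; rewrite ffunE eq_sym gh.
  by rewrite mulr0n.
elim/big_ind: _ => //; rewrite -(smash_elt0 1%g); exact: Pe.
Qed.

Fact smash_mul_linearl y : linear (smash_mul^~ y).
Proof.
move=> c x z; rewrite /smash_mul scaler_sumr -big_split /=.
apply: eq_bigr => g _; rewrite scaler_sumr -big_split /=.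
apply: eq_bigr => h _; rewrite -smash_eltP; congr smash_elt.
by rewrite !ffunE mulrDl scalerAl.
Qed.

Fact smash_mul_linearr x : linear (smash_mul x).
Proof.
move=> c y z; rewrite /smash_mul scaler_sumr -big_split /=.
apply: eq_bigr => g _; rewrite scaler_sumr -big_split /=.
apply: eq_bigr => h _; rewrite -smash_eltP; congr smash_elt.
by rewrite !ffunE linearP mulrDr scalerAr.
Qed.

Fact smash_mulDl : left_distributive smash_mul +%R.
Proof.
by move=> x y z; have := smash_mul_linearl z 1 x y; rewrite !scale1r.
Qed.

Fact smash_mulDr : right_distributive smash_mul +%R.
Proof.
by move=> x y z; have := smash_mul_linearr x 1 y z; rewrite !scale1r.
Qed.

Lemma smash_mul_elt a g b h :
  smash_mul (smash_elt a g) (smash_elt b h) = smash_elt (a * rho g b) (g * h)%g.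
Proof.
rewrite /smash_mul (bigD1 g) //= [X in _ + X]big1 ?addr0; last first.
  move=> g' /negPf g'g; rewrite big1 // => h' _.
  by rewrite ffunE g'g mulr0n mul0r smash_elt0.
rewrite (bigD1 h) //= [X in _ + X]big1 ?addr0; last first.
  move=> h' /negPf h'h.
  by rewrite [X in rho g X]ffunE h'h mulr0n raddf0 mulr0 smash_elt0.
by rewrite !ffunE !eqxx !mulr1n.
Qed.

Fact smash_mulA : associative smash_mul.
Proof.
move=> x y z; elim/smash_ind: x => [a g|x1 x2 IH1 IH2]; last first.
  by rewrite !smash_mulDl IH1 IH2.
elim/smash_ind: y => [b h|x1 x2 IH1 IH2]; last first.
  by rewrite smash_mulDl !smash_mulDr smash_mulDl IH1 IH2.
elim/smash_ind: z => [c k|x1 x2 IH1 IH2]; last first.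
  by rewrite !smash_mulDr IH1 IH2.
by rewrite !smash_mul_elt rmorphM /= actM mulrA mulgA.
Qed.

Fact smash_mul1 : left_id (smash_elt 1 1%g) smash_mul.
Proof.
move=> x; elim/smash_ind: x => [a g|x1 x2 IH1 IH2].
  by rewrite smash_mul_elt act1 mul1r mul1g.
by rewrite smash_mulDr IH1 IH2.
Qed.

Fact smash_mulr1 : right_id (smash_elt 1 1%g) smash_mul.
Proof.
move=> x; elim/smash_ind: x => [a g|x1 x2 IH1 IH2].
  by rewrite smash_mul_elt rmorph1 mulr1 mulg1.
by rewrite smash_mulDl IH1 IH2.
Qed.

Fact smash_1_neq0 : smash_elt 1 1%g != 0.
Proof.
apply/eqP=> /ffunP/(_ 1%g); rewrite !ffunE eqxx mulr1n => /eqP.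
by rewrite oner_eq0.
Qed.

HB.instance Definition _ := GRing.Zmodule_isNzRing.Build S
  smash_mulA smash_mul1 smash_mulr1 smash_mulDl smash_mulDr smash_1_neq0.

Fact smash_scaleAl (c : K) x y : c *: (x * y) = (c *: x) * y.
Proof.
rewrite -[c *: x]addr0 [RHS](smash_mul_linearl y c x 0).
by rewrite [X in _ = _ + X](mul0r y) addr0.
Qed.

HB.instance Definition _ := GRing.Lmodule_isLalgebra.Build K S smash_scaleAl.

Fact smash_scaleAr (c : K) x y : c *: (x * y) = x * (c *: y).
Proof.
rewrite -[c *: y]addr0 [RHS](smash_mul_linearr x c y 0).
by rewrite [X in _ = _ + X](mulr0 x) addr0.
Qed.

HB.instance Definition _ := GRing.Lalgebra_isAlgebra.Build K S smash_scaleAr.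

End Smash.

(* These actions exist, so assuming one given by u |-> zeta u, v |-> zeta^-1 v *)
(* is not vacuous.                                                            *)
Section Diagonal.
Variables (K : comNzRingType) (M : nmodType) (chi : M -> K).
Hypothesis chi0 : chi 0 = 1.
Hypothesis chiD : forall m m', chi (m + m') = chi m * chi m'.

Let diag : monoidAlg K M -> monoidAlg K M :=
  lin_ext (fun m => chi m *: monomial K m).

Lemma diag_lrmorphism :
  exists phi : {lrmorphism monoidAlg K M -> monoidAlg K M},
    forall m, phi (monomial K m) = chi m *: monomial K m.
Proof.
have diagE m : diag (monomial K m) = chi m *: monomial K m.
  exact: lin_ext_monomial.
have diagL c f g : diag (c *: f + g) = c *: diag f + diag g.
  exact: lin_ext_linear.
have diagP : monoid_morphism diag.
  split=> [|f g]; first by rewrite [LHS]diagE chi0 scale1r.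
  elim/monoidAlg_ind: f => [m|c f1 f2 IH1 IH2]; last first.
    by rewrite mulrDl -scalerAl !diagL IH1 IH2 mulrDl scalerAl.
  elim/monoidAlg_ind: g => [m'|c f1 f2 IH1 IH2]; last first.
    by rewrite mulrDr -scalerAr !diagL IH1 IH2 mulrDr scalerAr.
  rewrite !diagE [monomial K m * _]monomialM diagE chiD.
  by rewrite -scalerAl -scalerAr scalerA [monomial K m * _]monomialM.
pose I1 := GRing.isLinear.Build K _ _ _ diag (lin_ext_linear _).
pose I2 := GRing.isMonoidMorphism.Build _ _ diag diagP.
pose phi : {lrmorphism monoidAlg K M -> monoidAlg K M} :=
  HB.pack_for {lrmorphism monoidAlg K M -> monoidAlg K M} diag I1 I2.
by exists phi.
Qed.

End Diagonal.

Section CyclicAction.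
Variables (K : fieldType) (M : nmodType) (wt : M -> int).
Hypothesis wt0 : wt 0 = 0.
Hypothesis wtD : forall m m', wt (m + m') = wt m + wt m'.
Variables (Gamma : finGroupType) (xi : Gamma) (zeta : K).
Hypothesis xi_gen : <[xi]>%g = [set: Gamma].
Hypothesis zeta_prim : #[xi]%g.-primitive_root zeta.

Lemma cyclic_action_exists : exists rho : algAction (monoidAlg K M) Gamma,
  forall m, rho xi (monomial K m) = (zeta ^ wt m) *: monomial K m.
Proof.
have z0 : zeta != 0.
  apply/eqP=> z0; have := prim_expr_order zeta_prim.
  by rewrite z0 expr0n eqn0Ngt order_gt0 => /esym/eqP; rewrite oner_eq0.
have ex g : exists k, g == (xi ^+ k)%g.
  have /cycleP[k ->] : g \in <[xi]>%g by rewrite xi_gen inE.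
  by exists k.
pose ind g := xchoose (ex g).
have indE g : g = (xi ^+ ind g)%g by apply/eqP/(xchooseP (ex g)).
pose chi g m := (zeta ^+ ind g) ^ wt m.
have indP g k : g = (xi ^+ k)%g -> zeta ^+ ind g = zeta ^+ k.
  move=> gk; apply/eqP; rewrite (eq_prim_root_expr zeta_prim) -eq_expg_mod_order.
  by rewrite -indE gk.
have /choice[phi phiE] g : exists phi : {lrmorphism monoidAlg K M -> monoidAlg K M},
    forall m, phi (monomial K m) = chi g m *: monomial K m.
  apply: diag_lrmorphism => [|m m']; rewrite /chi ?wt0 // wtD expfzDr //.
  by rewrite expf_neq0.
have phi1 a : phi 1%g a = a.
  elim/monoidAlg_ind: a => [m|c a b IHa IHb]; last by rewrite linearP /= IHa IHb.
  by rewrite phiE /chi (indP _ 0%N) // expr0 exp1rz scale1r.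
have phiM g h a : phi (g * h)%g a = phi g (phi h a).
  elim/monoidAlg_ind: a => [m|c a b IHa IHb]; last by rewrite !linearP /= IHa IHb.
  rewrite !phiE linearZ /= phiE scalerA /chi (indP _ (ind h + ind g)%N).
    by rewrite exprD exprzMl ?unitfE ?expf_neq0.
  by rewrite addnC expgD -!indE.
exists (AlgAction phi1 phiM) => m /=.
by rewrite phiE /chi (indP _ 1%N).
Qed.

End CyclicAction.

Lemma laurent_action_exists (K : fieldType) (Gamma : finGroupType) (xi : Gamma)
    (zeta : K) :
  <[xi]>%g = [set: Gamma] -> #[xi]%g.-primitive_root zeta ->
  exists rho : algAction (laurent K) Gamma,
    rho xi (laurent_u K) = zeta *: laurent_u K
    /\ rho xi (laurent_v K) = zeta^-1 *: laurent_v K.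
Proof.
move=> xi_gen zeta_prim.
pose wt (m : int * int) := m.1 - m.2.
have wtD m m' : wt (m + m') = wt m + wt m' by rewrite /wt /= opprD addrACA.
have [rho rhoE] := cyclic_action_exists (erefl : wt 0 = 0) wtD xi_gen zeta_prim.
by exists rho; rewrite !rhoE.
Qed.

Lemma half_laurent_action_exists (K : fieldType) (Gamma : finGroupType)
    (xi : Gamma) (zeta : K) :
  <[xi]>%g = [set: Gamma] -> #[xi]%g.-primitive_root zeta ->
  exists rho : algAction (half_laurent K) Gamma,
    rho xi (half_laurent_u K) = zeta *: half_laurent_u K
    /\ rho xi (half_laurent_v K) = zeta^-1 *: half_laurent_v K.
Proof.
move=> xi_gen zeta_prim.
pose wt (m : int * nat) := m.1 - m.2%:Z.
have wtD m m' : wt (m + m') = wt m + wt m'.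
  by rewrite /wt /= PoszD opprD addrACA.
have [rho rhoE] := cyclic_action_exists (erefl : wt 0 = 0) wtD xi_gen zeta_prim.
by exists rho; rewrite !rhoE.
Qed.

(* Main.v *)
Require Import Defs.
From HB Require Import structures.
From mathcomp Require Import all_boot all_order all_algebra all_fingroup.
From mathcomp Require Import reals complex.
From mathcomp Require Import cyclic boolp.

Set Implicit Arguments.
Unset Strict Implicit.
Unset Printing Implicit Defensive.

Import GRing.Theory.
Local Open Scope ring_scope.

(** Write P for the algebra spanned by the monomials in u and v, with Gamma acting
by u -> zeta u and v -> zeta^-1 v.  The smash product acts on P, the element f g
by p -> f * g(p).  This action commutes with multiplication by the invariants,
which form the algebra generated by s = u^d (and its inverse) and t = u v: a
Laurent or half-Laurent polynomial algebra L again.  As u is invertible, P is free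
over L with basis 1, u, ..., u^(d-1), so writing the action in this basis gives
an algebra morphism from the smash product to the d x d matrices over L
([smash_mx], [smash_mxM]).

It is bijective ([smash_mx_bij]): the group algebra of Gamma contains the
idempotents e_j = d^-1 sum_g chi(g)^-j g, for chi the character of Gamma sending
xi to zeta, and the matrix unit E_ij scaled by a monomial of L comes from
u^a v^b e_j for a suitable monomial u^a v^b.  That this defines a two-sided
inverse is the orthogonality of the powers of chi, in both directions
([character_orthogonality], [character_dual_orthogonality]).

An n x n matrix of d x d matrices is an (n d) x (n d) matrix
([gl_block_isomorphic]), so gl_n of the smash product is isomorphic to gl_(nd)(L),
and an isomorphism of Lie algebras restricts to the derived algebras
([lie_isomorphic_derived]).

Both cases of the theorem are treated at once: all that is used of the monomials is
a commutative monoid M with an additive weight wt : M -> int (here a - b for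
u^a v^b) split by a morphism int -> M (the powers of u).  An element m of M is then
a power u^k, with k = wt m, times an element m0 of weight 0; identifying it with the
invariant (u^d)^k m0 makes the algebra of invariants a copy of the monoid algebra
of M itself.  In this labelling the monomial u^a v^b of the target stands for
s^(a-b) t^b. *)

(** * Derived algebras and block matrices *)

Lemma lie_isomorphic_derived (K : comNzRingType) (L1 L2 : lieAlgType K) :
  lie_isomorphic L1 L2 -> lie_isomorphic (derived L1) (derived L2).
Proof.
case=> f [g fK gK] fB.
have fD x : x \in in_derived (L := L1) -> f x \in in_derived (L := L2).
  case/in_derivedP=> s ->; apply/in_derivedP.
  exists [seq (p.1, (f p.2.1, f p.2.2)) | p <- s].
  rewrite linear_sum big_map; apply: eq_bigr => p _.
  by rewrite linearZ /= fB.
(* As f is injective and linear, g sends the image of a sum of brackets back to that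
   sum. *)
have gD y : y \in in_derived (L := L2) -> g y \in in_derived (L := L1).
  case/in_derivedP=> s ->; apply/in_derivedP.
  exists [seq (p.1, (g p.2.1, g p.2.2)) | p <- s].
  apply: (can_inj fK); rewrite gK linear_sum big_map; apply: eq_bigr => p _.
  by rewrite linearZ /= fB !gK.
pose F (x : derived L1) := Derived (fD _ (derived_valP x)).
pose G (y : derived L2) := Derived (gD _ (derived_valP y)).
have F_lin : linear F by move=> c x y; apply: val_inj; exact: linearP.
pose FL : {linear derived L1 -> derived L2} :=
  HB.pack_for {linear derived L1 -> derived L2} F
    (GRing.isLinear.Build K _ _ _ F F_lin).
exists FL => [|x y]; last by apply: val_inj; exact: fB.
by exists G => x; apply: val_inj; [exact: fK | exact: gK].
Qed.

(** Multiplication of block matrices: an algebra isomorphism from S to the d x d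
matrices over A, applied to each entry, turns an n x n matrix over S into a matrix
indexed by pairs of a block and a position inside it. *)
Lemma gl_block_isomorphic (K : comNzRingType) (S A : algType K) (n d : nat)
    (Theta : {linear S -> gl A d}) :
  bijective Theta ->
  (forall x y, Theta (x * y) = (Theta x : 'M[A]_d) *m (Theta y : 'M[A]_d)) ->
  lie_isomorphic (gl S n) (gl A (n * d)).
Proof.
case=> Theta' ThetaK Theta'K ThetaM.
have [split idxK splitK] := curry_mxvec_bij n d.
have {}idxK pi : split (uncurry (@mxvec_index n d) pi) = pi by exact: idxK.
have {}splitK a : uncurry (@mxvec_index n d) (split a) = a by exact: splitK.
pose entry (X : gl S n) p q : 'M[A]_d := Theta ((X : 'M[S]_n) p q).
pose F (X : gl S n) : gl A (n * d) :=
  (\matrix_(a, b) entry X (split a).1 (split b).1 (split a).2 (split b).2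
    : 'M[A]_(n * d)).
pose G (Y : gl A (n * d)) : gl S n :=
  (\matrix_(p, q) Theta' ((\matrix_(i, j)
     (Y : 'M[A]_(n * d)) (mxvec_index p i) (mxvec_index q j)) : 'M[A]_d)
    : 'M[S]_n).
have F_lin : linear F.
  move=> c X Y; apply/matrixP => a b; rewrite !mxE /entry.
  by rewrite !mxE linearP !mxE.
have FM (X Y : 'M[S]_n) : F (X *m Y) = (F X : 'M_(n * d)) *m (F Y : 'M_(n * d)).
  apply/matrixP => a b; rewrite !mxE /entry mxE linear_sum summxE.
  rewrite (reindex (uncurry (@mxvec_index n d))); last exact: curry_mxvec_bij.
  transitivity (\sum_p \sum_i F X a (mxvec_index p i) * F Y (mxvec_index p i) b);
    last by rewrite pair_bigA; apply: eq_bigr => -[p i] _.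
  apply: eq_bigr => p _; rewrite ThetaM mxE; apply: eq_bigr => i _.
  by rewrite !mxE (idxK (p, i)).
pose FL : {linear gl S n -> gl A (n * d)} :=
  HB.pack_for {linear gl S n -> gl A (n * d)} F
    (GRing.isLinear.Build K _ _ _ F F_lin).
exists FL => [|X Y]; last first.
  transitivity (F (X *m Y : 'M[S]_n) - F (Y *m X : 'M[S]_n)).
    exact: (raddfB FL (X *m Y : 'M[S]_n) (Y *m X : 'M[S]_n)).
  by rewrite !FM.
exists G => [X|Y]; apply/matrixP=> p q; rewrite !mxE.
  rewrite -[RHS]ThetaK; congr Theta'; apply/matrixP=> i j.
  by rewrite !mxE (idxK (p, i)) (idxK (q, j)).
rewrite /entry mxE Theta'K mxE.
by congr (Y _ _); [case: (split p) (splitK p) | case: (split q) (splitK q)].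
Qed.

(** * The characters of a cyclic group *)

Section CyclicSmash.
Variables (K : fieldType) (Gamma : finGroupType) (xi : Gamma) (zeta : K).
Hypothesis xi_gen : <[xi]>%g = [set: Gamma].
Hypothesis zeta_prim : #[xi]%g.-primitive_root zeta.

Lemma cyclic_character : exists2 chi : Gamma -> K,
  chi xi = zeta /\ (forall g, chi g ^+ #[xi]%g = 1) &
  {morph chi : g h / (g * h)%g >-> g * h} /\ injective chi.
Proof.
have /choice[ind indE] g : exists k, g = (xi ^+ k)%g.
  by apply/cycleP; rewrite xi_gen inE.
have zeta_expE i j : (zeta ^+ i == zeta ^+ j) = (xi ^+ i == xi ^+ j)%g.
  by rewrite (eq_prim_root_expr zeta_prim) eq_expg_mod_order.
exists (fun g => zeta ^+ ind g); split.
- by apply/eqP; rewrite -[X in _ == X]expr1 zeta_expE expg1 -indE.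
- by move=> g; rewrite exprAC (prim_expr_order zeta_prim) expr1n.
- by move=> g h; rewrite -exprD; apply/eqP; rewrite zeta_expE expgD -!indE.
- by move=> g h /eqP; rewrite zeta_expE -!indE => /eqP.
Qed.

Variable chi : Gamma -> K.
Hypothesis chi_xi : chi xi = zeta.
Hypothesis chiX : forall g, chi g ^+ #[xi]%g = 1.
Hypothesis chiM : {morph chi : g h / (g * h)%g >-> g * h}.
Hypothesis chi_inj : injective chi.
Local Notation d := #[xi]%g.

Lemma character_neq0 g : chi g != 0.
Proof.
apply/eqP=> g0; have := chiX g; rewrite g0 expr0n eqn0Ngt order_gt0 => /esym/eqP.
by rewrite oner_eq0.
Qed.

Lemma character_orthogonality (i j : 'I_d) :
  \sum_g chi g ^+ i / chi g ^+ j = d%:R *+ (i == j).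
Proof.
have [<-{j}|ij] := eqVneq i j.
  rewrite (eq_bigr (fun=> 1)) => [|g _]; last first.
    by rewrite divff // expf_neq0 ?character_neq0.
  by rewrite sumr_const -cardsT -xi_gen mulr1n.
set s := \sum_g _; pose c := zeta ^+ i / zeta ^+ j.
(* Translating the summation variable by xi multiplies the sum by c, and c != 1. *)
have sE : s = c * s.
  rewrite {1}/s (reindex_inj (mulgI xi)) mulr_sumr; apply: eq_bigr => g _ /=.
  by rewrite chiM chi_xi !exprMn invfM mulrACA.
have c1 : c != 1.
  have zj0 : zeta ^+ j != 0 by rewrite -chi_xi expf_neq0 ?character_neq0.
  rewrite /c -(inj_eq (mulIf zj0)) divfK // mul1r (eq_prim_root_expr zeta_prim).
  by rewrite !modn_small.
apply/eqP; rewrite mulr0n -[s == 0]orbF -(negbTE c1) orbC -subr_eq0 -mulf_eq0.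
by rewrite mulrBl mul1r -sE subrr.
Qed.

(** The geometric sum of a d-th root of unity; as chi is injective, the root is 1
only for h = g. *)
Lemma character_dual_orthogonality g h :
  \sum_(j < d) chi h ^+ j / chi g ^+ j = d%:R *+ (h == g).
Proof.
pose z := chi h / chi g.
rewrite (eq_bigr (fun j : 'I_d => z ^+ j)) => [|j _]; last first.
  by rewrite /z exprMn exprVn.
have [hg|hg] := eqVneq h g.
  by rewrite /z hg divff ?character_neq0 // (eq_bigr (fun=> 1)) => [|j _];
    rewrite ?expr1n // sumr_const card_ord mulr1n.
have z1 : z - 1 != 0.
  rewrite subr_eq0 /z -(inj_eq (mulIf (character_neq0 g))).
  by rewrite divfK ?character_neq0 // mul1r (inj_eq chi_inj).
apply: (mulfI z1); rewrite -subrX1 /z expr_div_n !chiX divr1 subrr.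
by rewrite mulr0n mulr0.
Qed.

(** * The action on Laurent polynomials as matrices *)

Lemma sumr_delta (V : nmodType) (I : finType) (r : I) (F : I -> V) :
  \sum_i F i *+ (i == r) = F r.
Proof.
by rewrite (bigD1 r) //= eqxx big1 ?addr0 // => i /negPf->.
Qed.

Fact residue_subproof (a : int) : (`|(a %% d)%Z| < d)%N.
Proof.
rewrite -ltz_nat gez0_abs ?modz_ge0 ?ltz_pmod // ?ltz_nat ?order_gt0 //.
by rewrite eqz_nat -lt0n order_gt0.
Qed.

Definition residue (a : int) : 'I_d := Ordinal (residue_subproof a).

Lemma d_neq0 : (d : int) != 0.
Proof. by rewrite eqz_nat -lt0n order_gt0. Qed.

Lemma residueE a : (residue a : int) = (a %% d)%Z.
Proof. by rewrite /= gez0_abs ?modz_ge0 ?d_neq0. Qed.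

Lemma residue_divz a : a = (a %/ d)%Z * d + (residue a : int).
Proof. by rewrite residueE -divz_eq. Qed.

Lemma residueMDl q a : residue (q * (d : int) + a) = residue a.
Proof. by apply/val_inj; rewrite /= modzMDl. Qed.

Lemma residue_small (i : 'I_d) : residue i = i.
Proof. by apply/val_inj; rewrite /= modz_nat modn_small. Qed.

Variables (M : nmodType) (wt : M -> int) (u : int -> M).
Hypothesis wtD : forall m m', wt (m + m') = wt m + wt m'.
Hypothesis uD : forall a b, u (a + b) = u a + u b.
Hypothesis u0 : u 0 = 0.
Hypothesis wt_u : forall a, wt (u a) = a.
Local Notation P := (monoidAlg K M).

Variable rho : algAction P Gamma.
Hypothesis rho_xi : forall m,
  rho xi (monomial K m) = zeta ^ wt m *: monomial K m.
Local Notation S := (smash rho).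

Lemma act_monomial g m : rho g (monomial K m) = chi g ^ wt m *: monomial K m.
Proof.
have /cycleP[k ->] : g \in <[xi]>%g by rewrite xi_gen inE.
elim: k => [|k IHk].
  have /eqP := chiM 1%g 1%g; rewrite mulg1 -{1}[chi 1%g]mulr1.
  rewrite (inj_eq (mulfI (character_neq0 _))) expg0 => /eqP <-.
  by rewrite Defs.act1 exp1rz scale1r.
rewrite expgSr Defs.actM rho_xi linearZ /= IHk scalerA chiM.
by rewrite exprzMl ?unitfE ?character_neq0 // chi_xi mulrC.
Qed.

Lemma smash_monomial_ind (Q : S -> Prop) :
  (forall m g, Q (smash_elt rho (monomial K m) g)) ->
  (forall c x y, Q x -> Q y -> Q (c *: x + y)) -> forall x, Q x.
Proof.
move=> Qm Qlin; elim/smash_ind=> [f g|x y Qx Qy].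
  elim/monoidAlg_ind: f => [//|c f1 f2 IH1 IH2].
  by rewrite smash_eltP; exact: Qlin.
by rewrite -[x]scale1r; exact: Qlin.
Qed.

(** In multiplicative notation, let m = u^(wt m) m0.  If wt m + j = q d + r with
0 <= r < d, then m u^j = u^r (u^(q d) m0).  The second factor is the invariant with
label u^q m0, which is m shifted by q - wt m, and it is the only nonzero coordinate
of m u^j in the basis 1, u, ..., u^(d-1). *)
Definition coord_mono (i j : 'I_d) (m : M) : P :=
  monomial K (m + u (((wt m + (j : int)) %/ d)%Z - wt m))
    *+ (i == residue (wt m + (j : int))).

(** The monomial that sends u^j to u^i times the invariant labelled by m: with k the
weight of m, the shift by k d - k restores that invariant from its label. *)
Definition embed_mono (i j : 'I_d) (m : M) : P :=
  monomial K (m + u (wt m * (d : int) + (i : int) - (j : int) - wt m)).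

Definition coord i j : {linear P -> P} := lin_ext (coord_mono i j).
Definition embed i j : {linear P -> P} := lin_ext (embed_mono i j).

Lemma coord_monomial i j m : coord i j (monomial K m) = coord_mono i j m.
Proof. exact: lin_ext_monomial. Qed.

Lemma embed_monomial i j m : embed i j (monomial K m) = embed_mono i j m.
Proof. exact: lin_ext_monomial. Qed.

Lemma coord_embed i k j f : coord k j (embed i j f) = f *+ (k == i).
Proof.
elim/monoidAlg_ind: f => [m|c f1 f2 IH1 IH2]; last first.
  by rewrite !linearP IH1 IH2 mulrnDl scalerMnr.
rewrite embed_monomial coord_monomial /coord_mono wtD wt_u.
set e := _ - wt m; have ->: wt m + e + (j : int) = wt m * (d : int) + (i : int).
  by rewrite /e addrCA subrr addr0 subrK.
rewrite residueMDl residue_small divzMDl ?d_neq0 // divz_nat divn_small //.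
rewrite -addrA -uD; congr (monomial K _ *+ _).
by rewrite [wt m + 0%Z]addr0 opprD addNKr subrr u0 addr0.
Qed.

Lemma sum_embed_coord j f : \sum_i embed i j (coord i j f) = f.
Proof.
elim/monoidAlg_ind: f => [m|c f1 f2 IH1 IH2]; last first.
  under eq_bigr do rewrite !linearP.
  by rewrite big_split /= -scaler_sumr IH1 IH2.
under eq_bigr do rewrite coord_monomial linearMn embed_monomial.
rewrite sumr_delta /embed_mono wtD wt_u [wt m + (_ - _)]addrC subrK.
by rewrite -residue_divz addrK -addrA -uD addrA subrK subrr u0 addr0.
Qed.

(** Column j holds the coordinates of the image of u^j; the group element g only
multiplies u^j by chi g ^ j. *)
Definition smash_mx (x : S) : gl P d :=
  (\matrix_(i, j) \sum_g chi g ^+ j *: coord i j (x g) : 'M[P]_d).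

Fact smash_mx_linear : linear smash_mx.
Proof.
move=> c x y; apply/matrixP=> i j; rewrite !mxE scaler_sumr -big_split.
apply: eq_bigr => g _; rewrite !ffunE linearP scalerDr /= !scalerA.
by rewrite [c * _]mulrC.
Qed.

HB.instance Definition _ :=
  GRing.isLinear.Build K S (gl P d) *:%R smash_mx smash_mx_linear.

Lemma smash_mx_elt m g i j :
  (smash_mx (smash_elt rho (monomial K m) g) : 'M[P]_d) i j
  = chi g ^+ j *: coord_mono i j m.
Proof.
rewrite mxE (bigD1 g) //= big1 ?addr0 => [|h /negPf hg].
  by rewrite ffunE eqxx mulr1n coord_monomial.
by rewrite ffunE hg mulr0n linear0 scaler0.
Qed.

Lemma smash_eltZ c (f : P) g : smash_elt rho (c *: f) g = c *: smash_elt rho f g.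
Proof. by rewrite -[c *: f]addr0 smash_eltP smash_elt0 addr0. Qed.

Lemma chi_residue g a : chi g ^+ residue a = chi g ^ a.
Proof.
rewrite {2}[a]residue_divz expfzDr ?character_neq0 //.
by rewrite [_ * (d : int)]mulrC -exprz_exp -exprnP chiX exp1rz mul1r.
Qed.

Lemma smash_mxM x y :
  smash_mx (x * y) = (smash_mx x : 'M[P]_d) *m (smash_mx y : 'M[P]_d).
Proof.
elim/smash_monomial_ind: x => [m g|c x1 x2 IH1 IH2]; last first.
  rewrite mulrDl -scalerAl !smash_mx_linear.
  rewrite [X in c *: X + _ = _]IH1 [X in _ + X = _]IH2.
  by rewrite [RHS]mulmxDl gl_mulZl.
elim/smash_monomial_ind: y => [m' h|c x1 x2 IH1 IH2]; last first.
  rewrite mulrDr -scalerAr !smash_mx_linear.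
  rewrite [X in c *: X + _ = _]IH1 [X in _ + X = _]IH2.
  by rewrite [RHS]mulmxDr gl_mulZr.
apply/matrixP=> i j.
pose r := residue (wt m' + (j : int)).
pose q := ((wt m' + (j : int)) %/ d)%Z.
(* In the product row by column only the index r contributes: the second factor
   sends u^j to a multiple of u^r. *)
have wE : wt (m + m') + (j : int) = q * (d : int) + (wt m + (r : int)).
  by rewrite wtD -addrA [wt m' + _]residue_divz addrCA.
rewrite [_ * _]smash_mul_elt act_monomial -scalerAr [monomial K m * _]monomialM.
rewrite smash_eltZ linearZ [LHS]mxE smash_mx_elt mxE.
rewrite (eq_bigr (fun k : 'I_d => (chi h ^+ j *: ((chi g ^+ k *: coord_mono i k m)
    * monomial K (m' + u (q - wt m')))) *+ (k == r))) => [|k _]; last first.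
  rewrite [X in X * _ = _]smash_mx_elt [X in _ * X = _]smash_mx_elt.
  by rewrite [coord_mono k j m']/coord_mono -scalerAr mulrnAr scalerMnr.
rewrite sumr_delta chi_residue expfzDr ?character_neq0 //.
rewrite /coord_mono wE residueMDl divzMDl ?d_neq0 //.
rewrite -scalerAl mulrnAl [monomial K _ * _]monomialM !scalerA.
congr (_ *: (monomial K _ *+ _)).
  by rewrite chiM exprMn mulrA mulrC.
rewrite addrACA -uD wtD opprD; congr (_ + u _).
by rewrite [RHS]addrACA [q + _]addrC.
Qed.

(** The inverse sends E_ij f to (the image of f under embed i j) e_j, where e_j is the
idempotent d^-1 sum_g chi(g)^-j g; the two orthogonality relations give the two
cancellations. *)
Lemma smash_mx_bij : bijective smash_mx.
Proof.
pose G (X : gl P d) : S := [ffun g => \sum_(i < d) \sum_(j < d)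
  (d%:R^-1 * (chi g ^+ j)^-1) *: embed i j ((X : 'M[P]_d) i j)].
have d0 : d%:R != 0 :> K := prim_root_natf_neq0 zeta_prim.
exists G => [x|X].
  apply/ffunP=> g; rewrite ffunE.
  transitivity (\sum_(j < d) \sum_h (d%:R^-1 * (chi h ^+ j / chi g ^+ j)) *: x h).
    rewrite exchange_big; apply: eq_bigr => j _ /=.
    under eq_bigr => i _ do rewrite mxE (linear_sum (embed i j)) scaler_sumr.
    rewrite exchange_big; apply: eq_bigr => h _ /=.
    under eq_bigr => i _ do rewrite linearZ scalerA /=.
    by rewrite -scaler_sumr sum_embed_coord -mulrA [_ / _]mulrC.
  rewrite exchange_big /=.
  under eq_bigr => h _.
    rewrite -scaler_suml -mulr_sumr character_dual_orthogonality.
    rewrite mulrnAr mulVf // -scalerMnl scale1r.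
    over.
  exact: sumr_delta.
apply/matrixP=> k l; rewrite mxE.
transitivity (\sum_(i < d) \sum_(j < d)
  (d%:R^-1 * \sum_g chi g ^+ l / chi g ^+ j)
     *: coord k l (embed i j ((X : 'M[P]_d) i j))).
  under eq_bigr do rewrite ffunE (linear_sum (coord k l)) scaler_sumr.
  rewrite exchange_big; apply: eq_bigr => i _ /=.
  under eq_bigr do rewrite (linear_sum (coord k l)) scaler_sumr.
  rewrite exchange_big; apply: eq_bigr => j _ /=.
  rewrite mulr_sumr scaler_suml; apply: eq_bigr => g _.
  by rewrite linearZ scalerA /= mulrCA.
under eq_bigr => i _.
  under eq_bigr => j _.
    rewrite character_orthogonality mulrnAr mulVf // -scalerMnl scale1r eq_sym.
    over.
  rewrite sumr_delta coord_embed eq_sym.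
  over.
exact: sumr_delta.
Qed.

End CyclicSmash.

(** * The isomorphism for a split graded monoid *)

(** The shift u splits the weight: its values are the powers of an invertible monomial
of weight 1, of which the first d form the basis over the invariants. *)
Theorem smash_sl_isomorphic (K : fieldType) (Gamma : finGroupType) (xi : Gamma)
    (zeta : K) (M : nmodType) (wt : M -> int) (u : int -> M)
    (rho : algAction (monoidAlg K M) Gamma) (n : nat) :
  <[xi]>%g = [set: Gamma] -> #[xi]%g.-primitive_root zeta ->
  (forall m m', wt (m + m') = wt m + wt m') ->
  (forall a b, u (a + b) = u a + u b) -> u 0 = 0 -> (forall a, wt (u a) = a) ->
  (forall m, rho xi (monomial K m) = zeta ^ wt m *: monomial K m) ->
  lie_isomorphic (sl (smash rho) n) (sl (monoidAlg K M) (n * #[xi]%g)).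
Proof.
move=> xi_gen zeta_prim wtD uD u0 wt_u rho_xi.
have [chi [chi_xi chiX] [chiM chi_inj]] := cyclic_character xi_gen zeta_prim.
apply: lie_isomorphic_derived.
apply: (@gl_block_isomorphic K (smash rho) (monoidAlg K M) n #[xi]%g
  (smash_mx xi chi wt u (rho := rho))).
  exact: (smash_mx_bij xi_gen zeta_prim chi_xi chiX chiM chi_inj
    wtD uD u0 wt_u).
exact: (smash_mxM xi_gen chi_xi chiX chiM wtD uD rho_xi).
Qed.

(** * The action on monomials is determined by u and v *)

Section MonomialEigenvectors.
Variables (K : fieldType) (M : nmodType) (wt : M -> int) (z : K).
Hypothesis wtD : forall m m', wt (m + m') = wt m + wt m'.
Hypothesis z0 : z != 0.
Variable phi : {lrmorphism monoidAlg K M -> monoidAlg K M}.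
Local Notation scaled m := (phi (monomial K m) = z ^ wt m *: monomial K m).

Lemma wt0 : wt 0 = 0.
Proof. by apply: (addrI (wt 0)); rewrite -wtD !addr0. Qed.

Lemma scaled_0 : scaled 0.
Proof. by rewrite wt0 scale1r; exact: rmorph1. Qed.

Lemma scaled_add m m' : scaled m -> scaled m' -> scaled (m + m').
Proof.
move=> Em Em'; rewrite -monomialM [LHS](rmorphM phi (monomial K m) (monomial K m')).
rewrite [X in X * _ = _]Em [X in _ * X = _]Em' wtD expfzDr //.
by rewrite -scalerAl -scalerAr scalerA.
Qed.

(** An algebra morphism respects inverses, so a monomial inverse to an eigenvector is
an eigenvector for the inverse eigenvalue; this is what reaches the negative powers
of u and v. *)
Lemma scaled_inv m m' : m + m' = 0 -> scaled m -> scaled m'.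
Proof.
move=> mm' Em.
have mono1 : monomial K m * monomial K m' = 1 by rewrite [LHS]monomialM mm'.
have wtN : wt m' = - wt m by apply: (addrI (wt m)); rewrite -wtD mm' wt0 subrr.
have e : (z ^ wt m *: monomial K m) * phi (monomial K m') = 1.
  by rewrite -[X in X * _ = _]Em -(rmorphM phi) mono1; exact: rmorph1.
rewrite -[LHS]mul1r -mono1 [monomial K m * _]mulrC -mulrA.
have -> : monomial K m * phi (monomial K m') = z ^ wt m' *: 1.
  by rewrite -e -scalerAl scalerA wtN -expfzDr // addNr scale1r.
by rewrite -scalerAr mulr1.
Qed.

Lemma scaled_nat (c : nat -> M) : c 0%N = 0 ->
  (forall k, c k.+1 = c 1%N + c k) -> scaled (c 1%N) -> forall k, scaled (c k).
Proof.
move=> c0 cS Ec; elim=> [|k IHk]; first by rewrite c0; exact: scaled_0.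
by rewrite cS; exact: scaled_add.
Qed.

Lemma scaled_int (c : int -> M) : c 0 = 0 ->
  (forall a b, c (a + b) = c a + c b) -> scaled (c 1) -> forall a, scaled (c a).
Proof.
move=> c0 cD Ec.
have En (k : nat) : scaled (c k).
  by apply: (scaled_nat (c := c)) => // k'; rewrite -cD -intS.
case=> k //; apply: scaled_inv (En k.+1).
by rewrite -cD NegzE subrr.
Qed.

End MonomialEigenvectors.

Lemma laurent_scaled (K : fieldType) (z : K)
    (phi : {lrmorphism laurent K -> laurent K}) : z != 0 ->
  phi (laurent_u K) = z *: laurent_u K ->
  phi (laurent_v K) = z^-1 *: laurent_v K ->
  forall m, phi (monomial K m) = z ^ (m.1 - m.2) *: monomial K m.
Proof.
move=> z0 phi_u phi_v [a b].
pose wt (m : int * int) := m.1 - m.2.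
have wtD m m' : wt (m + m') = wt m + wt m' by rewrite /wt /= opprD addrACA.
pose ua (a : int) : int * int := (a, 0).
pose vb (b : int) : int * int := (0, b).
have ua_scaled := scaled_int wtD z0 (c := ua) erefl (fun _ _ => erefl) phi_u a.
have vb_scaled := scaled_int wtD z0 (c := vb) erefl (fun _ _ => erefl) phi_v b.
rewrite -[_ - _]/(wt (a, b)).
have -> : (a, b) = ua a + vb b by congr pair; rewrite /= ?addr0 ?add0r.
exact (scaled_add wtD z0 ua_scaled vb_scaled).
Qed.

Lemma half_laurent_scaled (K : fieldType) (z : K)
    (phi : {lrmorphism half_laurent K -> half_laurent K}) : z != 0 ->
  phi (half_laurent_u K) = z *: half_laurent_u K ->
  phi (half_laurent_v K) = z^-1 *: half_laurent_v K ->
  forall m, phi (monomial K m) = z ^ (m.1 - m.2%:Z) *: monomial K m.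
Proof.
move=> z0 phi_u phi_v [a b].
pose wt (m : int * nat) := m.1 - m.2%:Z.
have wtD m m' : wt (m + m') = wt m + wt m'.
  by rewrite /wt /= PoszD opprD addrACA.
pose ua (a : int) : int * nat := (a, 0%N).
pose vb (b : nat) : int * nat := (0, b).
have ua_scaled := scaled_int wtD z0 (c := ua) erefl (fun _ _ => erefl) phi_u a.
have vb_scaled := scaled_nat wtD z0 (c := vb) erefl (fun _ => erefl) phi_v b.
rewrite -[_ - _]/(wt (a, b)).
have -> : (a, b) = ua a + vb b by congr pair; rewrite /= ?addr0 ?add0r.
exact (scaled_add wtD z0 ua_scaled vb_scaled).
Qed.

Theorem proposition4p1 (R : realType) (n d : nat) (hn : (2 <= n)%N)
    (hd : (1 <= d)%N)
    (Gamma : finGroupType) (xi : Gamma) (xi_gen : <[xi]>%g = [set: Gamma])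
    (xi_order : #[xi]%g = d)
    (zeta : R[i]) (zeta_prim : d.-primitive_root zeta)
    (rhoA : algAction (laurent R[i]) Gamma)
    (rhoA_u : rhoA xi (laurent_u R[i]) = zeta *: laurent_u R[i])
    (rhoA_v : rhoA xi (laurent_v R[i]) = zeta^-1 *: laurent_v R[i])
    (rhoB : algAction (half_laurent R[i]) Gamma)
    (rhoB_u : rhoB xi (half_laurent_u R[i]) = zeta *: half_laurent_u R[i])
    (rhoB_v : rhoB xi (half_laurent_v R[i]) = zeta^-1 *: half_laurent_v R[i]) :
  lie_isomorphic (sl (smash rhoA) n) (sl (laurent R[i]) (n * d)%N)
  /\ lie_isomorphic (sl (smash rhoB) n) (sl (half_laurent R[i]) (n * d)%N).
Proof.
have zeta0 : zeta != 0 by rewrite (prim_root_eq0 zeta_prim) -lt0n.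
subst d.
split.
- have wtD (m m' : int * int) :
      (m + m').1 - (m + m').2 = (m.1 - m.2) + (m'.1 - m'.2).
    by rewrite opprD addrACA.
  exact (smash_sl_isomorphic (u := fun a : int => (a, 0) : int * int) n
    xi_gen zeta_prim wtD (fun _ _ => erefl) erefl (@subr0 _)
    (laurent_scaled zeta0 rhoA_u rhoA_v)).
- have wtD (m m' : int * nat) :
      (m + m').1 - (m + m').2%:Z = (m.1 - m.2%:Z) + (m'.1 - m'.2%:Z).
    by rewrite PoszD opprD addrACA.
  exact (smash_sl_isomorphic (u := fun a : int => (a, 0%N) : int * nat) n
    xi_gen zeta_prim wtD (fun _ _ => erefl) erefl (@subr0 _)
    (half_laurent_scaled zeta0 rhoB_u rhoB_v)).
Qed.
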